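(* Every regular BiHom-alternative algebra $(A,\mu,\alpha,\beta)$ is BiHom-Malcev-admissible; that is, its commutator BiHom-algebra $A^-=(A,[\cdot,\cdot],\alpha,\beta)$, with $[x,y]=\mu(x,y)-\mu(\alpha^{-1}\beta(y),\alpha\beta^{-1}(x))$, is a BiHom-Malcev algebra.
   Context: All vector spaces are over an algebraically closed field $\mathbb{K}$ of characteristic $0$. For a quadruple $(A,\mu,\alpha,\beta)$ with $\mu:A\otimes A\to A$, $\alpha,\beta:A\to A$ linear, the BiHom-associator is $as_{\alpha,\beta}(x,y,z)=\mu(\mu(x,y),\beta(z))-\mu(\alpha(x),\mu(y,z))$. A BiHom-alternative algebra is such a quadruple with $\alpha\beta=\beta\alpha$, $\alpha\mu=\mu\alpha^{\otimes 2}$, $\beta\mu=\mu\beta^{\otimes 2}$ and, for all $x,y,z\in A$, $as_{\alpha,\beta}(\beta(x),\alpha(y),z)+as_{\alpha,\beta}(\beta(y),\alpha(x),z)=0$ and $as_{\alpha,\beta}(x,\beta(y),\alpha(z))+as_{\alpha,\beta}(x,\beta(z),\alpha(y))=0$. It is regular if $\alpha$ and $\beta$ are algebra automorphisms. For a quadruple $(A,[\cdot,\cdot],\alpha,\beta)$ with $[\cdot,\cdot]$ bilinear, the BiHom-Jacobiator is $$J_{\alpha,\beta}(x,y,z)=[\beta^2(x),[\beta(y),\alpha(z)]]+[\beta^2(y),[\beta(z),\alpha(x)]]+[\beta^2(z),[\beta(x),\alpha(y)]].$$ A BiHom-Malcev algebra is a quadruple $(A,[\cdot,\cdot],\alpha,\beta)$,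 with $\alpha,\beta:A\to A$ linear and $[\cdot,\cdot]$ bilinear, such that for all $x,y,z\in A$: (i) $\alpha\beta=\beta\alpha$; (ii) $\alpha([x,y])=[\alpha(x),\alpha(y)]$ and $\beta([x,y])=[\beta(x),\beta(y)]$; (iii) $[\beta(x),\alpha(y)]=-[\beta(y),\alpha(x)]$; (iv) $J_{\alpha,\beta}(\alpha\beta(x),\alpha\beta(y),[\beta(x),\alpha(z)])=[J_{\alpha,\beta}(\beta(x),\beta(y),\beta(z)),\alpha^2\beta^2(x)]$. *)

(* Defs.v *)
From HB Require Import structures.
From mathcomp Require Import all_boot all_order all_algebra.

Set Implicit Arguments.
Unset Strict Implicit.
Unset Printing Implicit Defensive.

Import GRing.Theory.
Local Open Scope ring_scope.

(* Structures are predicates on raw maps, so that proving that some data is a  *)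
(* BiHom-Malcev algebra includes proving (bi)linearity of that data; a linear  *)
(* map A (x) A -> A is encoded as a bilinear map A -> A -> A.                  *)

Section BiHom.
Variables (K : fieldType) (A : lmodType K).
Implicit Types (mu br : A -> A -> A) (alpha beta f : A -> A) (x y z : A).

Definition bihom_associator mu alpha beta x y z : A :=
  mu (mu x y) (beta z) - mu (alpha x) (mu y z).

Record bihom_alternative mu alpha beta : Prop := BiHomAlternative {
  alt_alpha_linear : linear alpha;
  alt_beta_linear : linear beta;
  alt_mu_bilinear : bilinear_for *:%R *:%R mu;
  alt_comm : alpha \o beta =1 beta \o alpha;
  alt_alphaM : {morph alpha : x y / mu x y};
  alt_betaM : {morph beta : x y / mu x y};
  alt_left x y z :
    bihom_associator mu alpha beta (beta x) (alpha y) z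
    + bihom_associator mu alpha beta (beta y) (alpha x) z = 0;
  alt_right x y z :
    bihom_associator mu alpha beta x (beta y) (alpha z)
    + bihom_associator mu alpha beta x (beta z) (alpha y) = 0
}.

Record algebra_automorphism mu f : Prop := AlgebraAutomorphism {
  aut_linear : linear f;
  aut_morph : {morph f : x y / mu x y};
  aut_bij : bijective f
}.

Record bihom_regular mu alpha beta : Prop := BiHomRegular {
  regular_alpha : algebra_automorphism mu alpha;
  regular_beta : algebra_automorphism mu beta
}.

Definition bihom_jacobiator br alpha beta x y z : A :=
  br (beta (beta x)) (br (beta y) (alpha z))
  + br (beta (beta y)) (br (beta z) (alpha x))
  + br (beta (beta z)) (br (beta x) (alpha y)).

Record bihom_malcev br alpha beta : Prop := BiHomMalcev {
  malcev_alpha_linear : linear alpha;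
  malcev_beta_linear : linear beta;
  malcev_bilinear : bilinear_for *:%R *:%R br;
  malcev_comm : alpha \o beta =1 beta \o alpha;
  malcev_alphaM : {morph alpha : x y / br x y};
  malcev_betaM : {morph beta : x y / br x y};
  malcev_skew x y : br (beta x) (alpha y) = - br (beta y) (alpha x);
  malcev_identity x y z :
    bihom_jacobiator br alpha beta
      (alpha (beta x)) (alpha (beta y)) (br (beta x) (alpha z))
    = br (bihom_jacobiator br alpha beta (beta x) (beta y) (beta z))
         (alpha (alpha (beta (beta x))))
}.

Lemma bij_preimage f (bij_f : bijective f) y : exists x, f x == y.
Proof. by case: bij_f => g _ fgK; exists (g y); rewrite fgK. Qed.

Definition bij_inv f (bij_f : bijective f) y : A :=
  xchoose (bij_preimage bij_f y).

Lemma bij_invK f (bij_f : bijective f) : cancel (bij_inv bij_f) f.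
Proof. by move=> y; apply/eqP/(xchooseP (bij_preimage bij_f y)). Qed.

Lemma bij_invKV f (bij_f : bijective f) : cancel f (bij_inv bij_f).
Proof. by move=> x; apply: (bij_inj bij_f); rewrite bij_invK. Qed.

Definition bihom_commutator mu alpha beta (reg : bihom_regular mu alpha beta)
    x y : A :=
  let alphaV := bij_inv (aut_bij (regular_alpha reg)) in
  let betaV := bij_inv (aut_bij (regular_beta reg)) in
  mu x y - mu (alphaV (beta y)) (alpha (betaV x)).

Definition bihom_malcev_admissible mu alpha beta
    (reg : bihom_regular mu alpha beta) : Prop :=
  bihom_malcev (bihom_commutator reg) alpha beta.

End BiHom.

(* Main.v *)
(** The product [x * y := mu (alpha^-1 x) (beta^-1 y)] untwists the structure:
    it is alternative, [alpha] and [beta] are automorphisms of it, and the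
    BiHom-commutator of [x], [y] is the [*]-commutator of [alpha x], [beta y].
    The BiHom-Malcev identity at [x], [y], [z] is then the Malcev identity of
    [*] at the images of [x], [y], [z] under [alpha^2 beta^3].  For alternative
    [*], the Jacobiator is [-6] times the associator, and the Malcev identity
    follows from two instances of the Teichmueller identity. *)
Require Import Defs.
From HB Require Import structures.
From mathcomp Require Import all_boot all_order all_algebra.

Set Implicit Arguments.
Unset Strict Implicit.
Unset Printing Implicit Defensive.

Import GRing.Theory.
Local Open Scope ring_scope.

(** Skew-symmetry yields only [assoc x x y *+ 2 = 0], so the identities below are doubled; this
    discards such 2-torsion terms from a Teichmueller identity. *)
Lemma cancel_twice (V : zmodType) (a b c d : V) :
  a + b = c + d -> b *+ 2 = 0 -> d *+ 2 = 0 -> a *+ 2 = c *+ 2.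
Proof.
move=> /(congr1 (fun u => u *+ 2)); rewrite !mulrnDl => + b0 d0.
by rewrite b0 d0 !addr0.
Qed.

(** * Malcev identity for commutators in an alternative algebra *)

Section Alternative.
Variables (K : nzRingType) (A : lmodType K) (mul : {bilinear A -> A -> A}).
Implicit Types w x y z : A.

Definition assoc x y z : A := mul (mul x y) z - mul x (mul y z).
Definition comm x y : A := mul x y - mul y x.
Definition jacobiator x y z : A :=
  comm x (comm y z) + comm y (comm z x) + comm z (comm x y).

Lemma comm_bilinear : bilinear_for *:%R *:%R comm.
Proof.
by split=> u a x y; rewrite /comm linearPl linearPr /= scalerBr opprD addrACA.
Qed.

HB.instance Definition _ :=
  bilinear_isBilinear.Build K A A A *:%R *:%R comm comm_bilinear.

Lemma commC x y : comm x y = - comm y x.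
Proof. by rewrite /comm opprB. Qed.

Lemma teichmueller w x y z :
  assoc (mul w x) y z - assoc w (mul x y) z + assoc w x (mul y z) =
  mul w (assoc x y z) + mul (assoc w x y) z.
Proof.
rewrite /assoc linearBl linearBr !opprD !opprK !addrA.
(* Terms 2 and 5 are the opposite copies of [mul (mul w x) (mul y z)]. *)
by rewrite [LHS](ACl (4*6*1*3*2*5))/= addrNK.
Qed.

Hypothesis assocCl : forall x y z, assoc x y z = - assoc y x z.
Hypothesis assocCr : forall x y z, assoc x y z = - assoc x z y.

Lemma assoc_rot x y z : assoc x y z = assoc y z x.
Proof. by rewrite assocCl assocCr opprK. Qed.

Lemma assoc_xxD x y : assoc x x y *+ 2 = 0.
Proof. by rewrite mulr2n {1}assocCl addNr. Qed.

(** Teichmueller at [x, x, z, y]: both associators that start with [x, x] vanish after doubling. *)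
Lemma assoc_mull x y z :
  assoc x y (mul x z) *+ 2 = (assoc (mul x x) y z - mul x (assoc x y z)) *+ 2.
Proof.
have D : (assoc (mul x x) z y - assoc x (mul x z) y) *+ 2 =
    mul x (assoc x z y) *+ 2.
  apply: (cancel_twice (teichmueller x x z y)); first exact: assoc_xxD.
  by rewrite -linearMnl assoc_xxD linear0l.
rewrite -linearNr -assocCr (mulrnDl 2 _ (mul x _)) -D -(mulrnDl 2).
by congr (_ *+ 2); rewrite (assocCr _ z y) addNKr -assocCr.
Qed.

(** Mirror image, from Teichmueller at [y, z, x, x]. The term [assoc (mul x x) y z] is the same as
    in [assoc_mull], so it drops out of the difference in [assoc_comm]. *)
Lemma assoc_mulr x y z :
  assoc x y (mul z x) *+ 2 = (assoc (mul x x) y z - mul (assoc x y z) x) *+ 2.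
Proof.
have T := teichmueller y z x x.
rewrite -addrA [LHS]addrC [RHS]addrC in T.
have D : (- assoc y (mul z x) x + assoc y z (mul x x)) *+ 2 =
    mul (assoc y z x) x *+ 2.
  apply: (cancel_twice T); first by rewrite assoc_rot assoc_xxD.
  by rewrite -linearMnr assoc_rot assoc_xxD linear0r.
rewrite (assoc_rot x y z) (mulrnBl 2 _ (mul _ x)) -D -(mulrnBl 2).
congr (_ *+ 2); rewrite -(assoc_rot x y) (assoc_rot _ y z).
by rewrite opprD opprK addrCA subrr addr0.
Qed.

Lemma assoc_comm x y z : assoc x y (comm x z) *+ 2 = comm (assoc x y z) x *+ 2.
Proof.
have assocB u v : assoc x y (u - v) = assoc x y u - assoc x y v.
  by rewrite /assoc !linearBr !opprD !opprK addrACA.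
rewrite assocB mulrnBl assoc_mull assoc_mulr -mulrnBl; congr (_ *+ 2).
by rewrite opprB addrC addrA addrNK.
Qed.

Lemma jacobiator_assoc x y z : jacobiator x y z = - (assoc x y z *+ 6).
Proof.
(* The twelve monomials form the six permuted associators, odd minus even; each contributes
   [- assoc x y z]. *)
have -> : jacobiator x y z =
    (assoc x z y + assoc y x z + assoc z y x)
    - (assoc x y z + assoc y z x + assoc z x y).
  rewrite /jacobiator /comm /assoc !linearBl !linearBr !opprD !opprK !addrA.
  by rewrite [LHS](ACl (8*2*12*6*4*10*11*1*3*5*7*9)).
rewrite (assocCr x z y) (assocCl y x z) (assocCl z y x) -(assoc_rot x y z).
rewrite (assoc_rot z x y) -!opprD; congr (- _).
by rewrite (mulrnDr _ 3 3) mulrSr.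
Qed.

Lemma jacobiator_comm x y z :
  jacobiator x y (comm x z) = comm (jacobiator x y z) x.
Proof.
rewrite !jacobiator_assoc linearNl linearMnl; congr (- _).
(* The factor 6 = 2 * 3 absorbs the doubling in [assoc_comm]. *)
by rewrite !(mulrnA _ 2 3) assoc_comm.
Qed.

End Alternative.

(** * Twisting the Malcev identity by [alpha] and [beta] *)

Section YauTwist.
Variables (K : fieldType) (A : lmodType K) (mul : {bilinear A -> A -> A}).
Variables (alpha beta : {linear A -> A}) (br : A -> A -> A).
Hypothesis assocCl : forall x y z, assoc mul x y z = - assoc mul y x z.
Hypothesis assocCr : forall x y z, assoc mul x y z = - assoc mul x z y.
Hypothesis alphaM : {morph alpha : x y / mul x y}.
Hypothesis betaM : {morph beta : x y / mul x y}.
Hypothesis alpha_beta : forall x, alpha (beta x) = beta (alpha x).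
Hypothesis brE : forall x y, br x y = comm mul (alpha x) (beta y).

Lemma alpha_comm x y : alpha (comm mul x y) = comm mul (alpha x) (alpha y).
Proof. by rewrite raddfB /= !alphaM. Qed.

Lemma beta_comm x y : beta (comm mul x y) = comm mul (beta x) (beta y).
Proof. by rewrite raddfB /= !betaM. Qed.

Lemma bihom_jacobiator_twist x y z :
  bihom_jacobiator br alpha beta x y z =
  jacobiator mul (beta (beta (alpha x))) (beta (beta (alpha y)))
    (beta (beta (alpha z))).
Proof. by rewrite /bihom_jacobiator !brE !beta_comm !alpha_beta. Qed.

Lemma alpha_jacobiator x y z :
  alpha (jacobiator mul x y z) = jacobiator mul (alpha x) (alpha y) (alpha z).
Proof. by rewrite 2!raddfD /= !alpha_comm. Qed.

Lemma bihom_malcev_twist : bihom_malcev br alpha beta.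
Proof.
split.
- exact: linearP.
- exact: linearP.
- by split=> u a x y; rewrite !brE linearP ?linearPl ?linearPr.
- exact: alpha_beta.
- by move=> x y; rewrite !brE alpha_comm alpha_beta.
- by move=> x y; rewrite !brE beta_comm alpha_beta.
- by move=> x y; rewrite !brE commC !alpha_beta.
- move=> x y z.
  rewrite !bihom_jacobiator_twist !brE alpha_jacobiator.
  rewrite !alpha_comm !beta_comm !alpha_beta.
  exact: jacobiator_comm.
Qed.

End YauTwist.

(** * Untwisting a regular BiHom-alternative algebra *)

Section Untwist.
Variables (K : fieldType) (A : lmodType K).
Variables (mu : A -> A -> A) (alpha beta : A -> A).
Hypothesis alt : bihom_alternative mu alpha beta.
Hypothesis reg : bihom_regular mu alpha beta.

Let alphaV := bij_inv (aut_bij (regular_alpha reg)).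
Let betaV := bij_inv (aut_bij (regular_beta reg)).
Let alphaVK : cancel alphaV alpha. Proof. exact: bij_invK. Qed.
Let betaVK : cancel betaV beta. Proof. exact: bij_invK. Qed.
Let alphaKV : cancel alpha alphaV. Proof. exact: bij_invKV. Qed.
Let betaKV : cancel beta betaV. Proof. exact: bij_invKV. Qed.
Let alpha_beta x : alpha (beta x) = beta (alpha x).
Proof. exact: (alt_comm alt). Qed.

Definition untwist x y : A := mu (alphaV x) (betaV y).

Lemma untwistE x y : mu x y = untwist (alpha x) (beta y).
Proof. by rewrite /untwist alphaKV betaKV. Qed.

Lemma untwist_bilinear : bilinear_for *:%R *:%R untwist.
Proof.
have aVP : linear alphaV.
  move=> a x y; apply: (can_inj alphaKV).
  by rewrite (alt_alpha_linear alt) !alphaVK.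
have bVP : linear betaV.
  move=> a x y; apply: (can_inj betaKV).
  by rewrite (alt_beta_linear alt) !betaVK.
have [mulPl mulPr] := alt_mu_bilinear alt.
by split=> u a x y; rewrite /untwist ?aVP ?bVP ?mulPl ?mulPr.
Qed.

Lemma alpha_untwist : {morph alpha : x y / untwist x y}.
Proof.
move=> x y; rewrite (alt_alphaM alt) untwistE alphaVK.
by rewrite -alpha_beta betaVK.
Qed.

Lemma beta_untwist : {morph beta : x y / untwist x y}.
Proof.
move=> x y; rewrite (alt_betaM alt) untwistE alpha_beta alphaVK.
by rewrite betaVK.
Qed.

HB.instance Definition _ :=
  bilinear_isBilinear.Build K A A A *:%R *:%R untwist untwist_bilinear.

Lemma bihom_associator_untwist x y z :
  bihom_associator mu alpha beta x y z =
  assoc untwist (alpha (alpha x)) (beta (alpha y)) (beta (beta z)).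
Proof.
rewrite /bihom_associator /assoc !untwistE.
by rewrite !alpha_untwist !beta_untwist !alpha_beta.
Qed.

Lemma untwist_assocCl x y z : assoc untwist x y z = - assoc untwist y x z.
Proof.
apply/eqP; rewrite -addr_eq0; apply/eqP.
(* In [alt_left] the first two variables reach [assoc untwist] under alpha^2 beta and the third
   under beta^2; these preimages undo that. *)
have := alt_left alt (alphaV (alphaV (betaV x))) (alphaV (alphaV (betaV y)))
  (betaV (betaV z)).
by rewrite !bihom_associator_untwist !alpha_beta !alphaVK !betaVK.
Qed.

Lemma untwist_assocCr x y z : assoc untwist x y z = - assoc untwist x z y.
Proof.
apply/eqP; rewrite -addr_eq0; apply/eqP.
(* Here the maps to undo are alpha^2 on the first variable and alpha beta^2 on the others. *)
have := alt_right alt (alphaV (alphaV x)) (alphaV (betaV (betaV y)))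
  (alphaV (betaV (betaV z))).
by rewrite !bihom_associator_untwist !alpha_beta !alphaVK !betaVK.
Qed.

(** The inverse maps in the second term cancel those added by [untwistE], leaving
    [untwist (beta y) (alpha x)]. *)
Lemma bihom_commutator_untwist x y :
  bihom_commutator reg x y = comm untwist (alpha x) (beta y).
Proof.
rewrite /bihom_commutator -/alphaV -/betaV !untwistE /comm alphaVK.
by rewrite -alpha_beta betaVK.
Qed.

Lemma bihom_malcev_admissible_alternative : bihom_malcev_admissible reg.
Proof.
pose a : {linear A -> A} :=
  HB.pack alpha (GRing.isLinear.Build K A A *:%R alpha (alt_alpha_linear alt)).
pose b : {linear A -> A} :=
  HB.pack beta (GRing.isLinear.Build K A A *:%R beta (alt_beta_linear alt)).
apply: (@bihom_malcev_twist K A untwist a b).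
- exact: untwist_assocCl.
- exact: untwist_assocCr.
- exact: alpha_untwist.
- exact: beta_untwist.
- exact: alpha_beta.
- exact: bihom_commutator_untwist.
Qed.

End Untwist.

Theorem theorem2p2 (K : closedFieldType) (K_char0 : [pchar K] =i pred0)
    (A : lmodType K) (mu : A -> A -> A) (alpha beta : A -> A)
    (alt : bihom_alternative mu alpha beta)
    (reg : bihom_regular mu alpha beta) :
  bihom_malcev_admissible reg.
Proof. exact: bihom_malcev_admissible_alternative. Qed.
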